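(* Let $X$ be a locally path connected space and $x\in X$. For every subgroup $H$ of $\pi_1^{qtop}(X,x)$, $H$ is open in $\pi_1^{qtop}(X,x)$ if and only if there exists a path open cover $\mathcal{V}=\{V_{\alpha}\mid\alpha\in P(X,x)\}$ of $(X,x)$ such that $\widetilde{\pi}(\mathcal{V},x)\leq H$.
   Context: $P(X,x)$ is the set of all paths $\alpha:[0,1]\to X$ with $\alpha(0)=x$. A path open cover of a pointed space $(X,x)$ is an open cover $\mathcal{V}=\{V_{\alpha}\mid\alpha\in P(X,x)\}$ of $X$, indexed by $P(X,x)$, such that $\alpha(1)\in V_{\alpha}$ for every $\alpha\in P(X,x)$. The path Spanier group $\widetilde{\pi}(\mathcal{V},x)$ with respect to the path open cover $\mathcal{V}$ is the subgroup of $\pi_1(X,x)$ consisting of all homotopy classes having a representative of the form $\prod_{j=1}^{n}u_jv_ju_j^{-1}$, where each $u_j$ is an arbitrary path starting at $x$ and each $v_j$ is a loop based at $u_j(1)$ lying inside $V_{u_j}$. The quasitopological fundamental group $\pi_1^{qtop}(X,x)$ is the group $\pi_1(X,x)$ with the quotient topology induced by the map $q:\Omega(X,x)\to\pi_1(X,x)$, $q(\gamma)=[\gamma]$, where $\Omega(X,x)$ is the space of loops in $X$ based at $x$ with the compact-open topology. *)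

(* Defs.v *)
From HB Require Import structures.
From mathcomp Require Import all_boot all_order all_algebra generic_quotient.
From mathcomp Require Import all_classical all_reals.
From mathcomp Require Import topology normedtype homotopy.
From mathcomp Require Import lra.

Set Implicit Arguments.
Unset Strict Implicit.
Unset Printing Implicit Defensive.

Import Order.TTheory GRing.Theory Num.Theory.
Import numFieldNormedType.Exports.

Local Open Scope classical_set_scope.
Local Open Scope ring_scope.
Local Open Scope quotient_scope.

Section unit_interval.
Context (R : realType).

Definition unit_interval : Type := set_type (`[0, 1]%classic : set R).

HB.instance Definition _ := 
  Topological.copy unit_interval (set_type (`[0, 1]%classic : set R)).

Definition I_val (t : unit_interval) : R := \val t.

Lemma I_valP t : 0 <= I_val t <= 1.
Proof. by have := set_mem (valP t); rewrite /= in_itv. Qed.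

Lemma I_val_inj : injective I_val.
Proof. exact: val_inj. Qed.

Lemma I_clamp_subproof (r : R) :
  Num.max 0 (Num.min 1 r) \in (`[0, 1]%classic : set R).
Proof.
by apply/mem_set; rewrite /= in_itv /= le_max lexx ge_max ler01 ge_min lexx.
Qed.

Definition I_clamp (r : R) : unit_interval := 
  exist (fun t => t \in (`[0, 1]%classic : set R)) _ (I_clamp_subproof r).

Lemma I_clampE r : I_val (I_clamp r) = Num.max 0 (Num.min 1 r).
Proof. by []. Qed.

Lemma I_valK : cancel I_val I_clamp.
Proof.
move=> t; apply: I_val_inj; rewrite I_clampE.
by have /andP[t0 t1] := I_valP t; rewrite (min_r t1) (max_r t0).
Qed.

Lemma I_zero_neq_one : I_clamp 0 != I_clamp 1.
Proof.
apply/eqP => /(congr1 I_val); rewrite !I_clampE.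
by rewrite (min_r ler01) maxxx minxx (max_r ler01) => /esym/eqP; rewrite oner_eq0.
Qed.

HB.instance Definition _ := isBiPointed.Build unit_interval I_zero_neq_one.

End unit_interval.


Section I_topology.
Context {R : realType}.
Local Notation I := (unit_interval R).


Lemma I_val_continuous : continuous (@I_val R : I -> R).
Proof. exact: initial_continuous. Qed.

Lemma glue_continuous (Z X : topologicalType) (a b : Z -> R) (f g : Z -> X) :
  continuous a -> continuous b -> continuous f -> continuous g ->
  (forall z, a z = b z -> f z = g z) ->
  continuous (fun z => if a z <= b z then f z else g z).
Proof.
move=> ca cb cf cg fg.
set h := (fun z => if a z <= b z then f z else g z).
pose A := [set z | a z <= b z]; pose B := [set z | b z <= a z].
have cd : continuous (fun z => b z - a z).
  by move=> z; apply: cvgB; [exact: cb|exact: ca].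
have cA : closed A.
  rewrite (_ : A = (fun z => b z - a z) @^-1` [set y | 0 <= y]).
    by apply: (closed_comp (fun x _ => cd x)) (@closed_ge _ 0).
  by apply/seteqP; split => z /=; rewrite /A/= subr_ge0.
have cB : closed B.
  rewrite (_ : B = (fun z => b z - a z) @^-1` [set y | y <= 0]).
    by apply: (closed_comp (fun x _ => cd x)) (@closed_le _ 0).
  by apply/seteqP; split => z /=; rewrite /B/= subr_le0.
have AB : A `|` B = setT.
  apply/seteqP; split => // z _; rewrite /A /B /=.
  by case: (leP (a z) (b z)) => [|/ltW]; [left|right].
apply/continuous_subspace_setT; rewrite -AB; apply: withinU_continuous => //.
- apply: (@subspace_eq_continuous Z A X f); last exact: continuous_subspaceT.
  by move=> z /set_mem Az; change (f z = h z); rewrite /h ifT.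
- apply: (@subspace_eq_continuous Z B X g); last exact: continuous_subspaceT.
  move=> z /set_mem Bz; change (g z = h z); rewrite /h; case: ifPn => // ab.
  by rewrite fg //; apply/eqP; rewrite eq_le ab Bz.
Qed.

Lemma I_continuous (Z : topologicalType) (h : Z -> I) :
  continuous (fun z => I_val (h z)) -> continuous h.
Proof. by move=> ch; apply: continuous_comp_initial. Qed.

Lemma I_clamp_continuous (Z : topologicalType) (a : Z -> R) :
  continuous a -> continuous (fun z => I_clamp (a z)).
Proof.
move=> ca; apply: I_continuous; under eq_fun do rewrite I_clampE.
apply: max_fun_continuous; first exact: cst_continuous.
by apply: min_fun_continuous => //; exact: cst_continuous.
Qed.

Lemma I_val_comp_continuous (Z : topologicalType) (h : Z -> I) :
  continuous h -> continuous (fun z => I_val (h z)).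
Proof.
by move=> ch z; apply: continuous_comp; [exact: ch|exact: I_val_continuous].
Qed.

End I_topology.

Lemma pair_continuous (Z T U : topologicalType) (a : Z -> T) (b : Z -> U) :
  continuous a -> continuous b -> continuous (fun z => (a z, b z)).
Proof. by move=> ca cb z; apply: cvg_pair; [exact: ca|exact: cb]. Qed.

Lemma comp_continuous (Z T U : topologicalType) (a : Z -> T) (b : T -> U) :
  continuous a -> continuous b -> continuous (fun z => b (a z)).
Proof. by move=> ca cb z; apply: continuous_comp; [exact: ca|exact: cb]. Qed.

Lemma fst_continuous (Z T : topologicalType) : continuous (@fst Z T).
Proof. by move=> z; exact: cvg_fst. Qed.

Lemma snd_continuous (Z T : topologicalType) : continuous (@snd Z T).
Proof. by move=> z; exact: cvg_snd. Qed.


Section path_operations.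
Context {R : realType} {X : topologicalType}.
Local Notation I := (unit_interval R).

Definition concat_fun (p q : I -> X) (t : I) : X :=
  if I_val t <= 2^-1 then p (I_clamp (2 * I_val t))
  else q (I_clamp (2 * I_val t - 1)).

Lemma I_val0 : I_val (zero : I) = 0.
Proof. by rewrite I_clampE (min_r ler01) maxxx. Qed.

Lemma I_val1 : I_val (one : I) = 1.
Proof. by rewrite I_clampE minxx (max_r ler01). Qed.

Lemma I_clamp_le0 (r : R) : r <= 0 -> I_clamp r = zero.
Proof.
move=> r0; apply: I_val_inj; rewrite I_val0 I_clampE.
by rewrite (min_r (le_trans r0 ler01)) (max_l r0).
Qed.

Lemma I_clamp_ge1 (r : R) : 1 <= r -> I_clamp r = one.
Proof.
by move=> r1; apply: I_val_inj; rewrite I_val1 I_clampE (min_l r1) max_r.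
Qed.

Lemma I_val_clamp (r : R) : 0 <= r <= 1 -> I_val (I_clamp r) = r.
Proof. by move=> /andP[r0 r1]; rewrite I_clampE (min_r r1) (max_r r0). Qed.

Lemma addc_continuous (Z : topologicalType) (a : Z -> R) (c : R) :
  continuous a -> continuous (fun z => a z + c).
Proof. by move=> ca z; apply: cvgD; [exact: ca|exact: cvg_cst]. Qed.

Lemma mulc_continuous (Z : topologicalType) (a : Z -> R) (c : R) :
  continuous a -> continuous (fun z => c * a z).
Proof. by move=> ca z; apply: cvgM; [exact: cvg_cst|exact: ca]. Qed.

Lemma flip_continuous (Z : topologicalType) (a : Z -> I) :
  continuous a -> continuous (fun z => I_clamp (1 - I_val (a z))).
Proof.
move=> /I_val_comp_continuous ca; apply: I_clamp_continuous => z.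
by apply: cvgB; [exact: cvg_cst|exact: ca].
Qed.

Lemma concat_continuous (Z : topologicalType) (a : Z -> I) (f g : Z * I -> X) :
  continuous a -> continuous f -> continuous g ->
  (forall z, f (z, one) = g (z, zero)) ->
  continuous (fun z : Z => concat_fun (fun t => f (z, t)) (fun t => g (z, t)) (a z)).
Proof.
move=> ca cf cg fg; have va := I_val_comp_continuous ca.
apply: glue_continuous => //.
- exact: cst_continuous.
- apply: (comp_continuous _ cf); apply: pair_continuous; first by move=> ?; exact: cvg_id.
  by apply: I_clamp_continuous; exact: mulc_continuous.
- apply: (comp_continuous _ cg); apply: pair_continuous; first by move=> ?; exact: cvg_id.
  by apply: I_clamp_continuous; apply: addc_continuous; exact: mulc_continuous.
- move=> z az; rewrite I_clamp_ge1 ?I_clamp_le0 ?fg //; lra.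
Qed.

Section concat.
Context {x y z : X} (p : {path I from x to y}) (q : {path I from y to z}).

Lemma concat_fun_continuous : continuous (concat_fun p q).
Proof.
have H (r : I -> X) : continuous r -> continuous (fun w : I * I => r w.2).
  by move=> cr w; apply: continuous_comp; [exact: cvg_snd|exact: cr].
apply: (@concat_continuous I id (fun w => p w.2) (fun w => q w.2)).
- by move=> ?; exact: cvg_id.
- by apply: H; exact: cts_fun.
- by apply: H; exact: cts_fun.
- by move=> ? /=; rewrite path_one path_zero.
Qed.

Lemma concat_fun_zero : concat_fun p q zero = x.
Proof.
by rewrite /concat_fun I_val0 invr_ge0 ler0n I_clamp_le0 ?mulr0 // path_zero.
Qed.

Lemma concat_fun_one : concat_fun p q one = z.
Proof.
rewrite /concat_fun I_val1 ifF; last by apply/negbTE; lra.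
by rewrite I_clamp_ge1 ?path_one //; lra.
Qed.

Definition concat : {path I from x to z} :=
  mk_path concat_fun_continuous concat_fun_zero concat_fun_one.

Lemma concatE t : concat t =
  if I_val t <= 2^-1 then p (I_clamp (2 * I_val t))
  else q (I_clamp (2 * I_val t - 1)).
Proof. by []. Qed.

End concat.

Section path_inverse.
Context {x y : X} (p : {path I from x to y}).

Definition inverse_fun (t : I) : X := p (I_clamp (1 - I_val t)).

Lemma inverse_fun_continuous : continuous inverse_fun.
Proof.
apply: (@comp_continuous _ _ _ (fun t => I_clamp (1 - I_val t))).
  by apply: (@flip_continuous I id) => t; exact: cvg_id.
exact: cts_fun.
Qed.

Lemma inverse_fun_zero : inverse_fun zero = y.
Proof. by rewrite /inverse_fun I_val0 I_clamp_ge1 ?subr0 // path_one. Qed.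

Lemma inverse_fun_one : inverse_fun one = x.
Proof. by rewrite /inverse_fun I_val1 I_clamp_le0 ?subrr // path_zero. Qed.

Definition inverse : {path I from y to x} :=
  mk_path inverse_fun_continuous inverse_fun_zero inverse_fun_one.

Lemma inverseE t : inverse t = p (I_clamp (1 - I_val t)).
Proof. by []. Qed.

End path_inverse.

Definition constant (x : X) : {path I from x to x} := cst x.

Definition homotopic {x y : X} (p q : {path I from x to y}) : Prop :=
  exists F : I * I -> X,
    [/\ continuous F,
        forall s, F (s, zero) = p s,
        forall s, F (s, one) = q s,
        forall t, F (zero, t) = x &
        forall t, F (one, t) = y].

Lemma homotopic_refl x y (p : {path I from x to y}) : homotopic p p.
Proof.
exists (fun w => p w.1); split => //= [|t|t].
- exact: (comp_continuous (@fst_continuous _ _) (@cts_fun _ _ p)).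
- exact: path_zero.
- exact: path_one.
Qed.

Lemma homotopic_sym x y (p q : {path I from x to y}) :
  homotopic p q -> homotopic q p.
Proof.
move=> [F [cF Fp Fq Fx Fy]].
exists (fun w => F (w.1, I_clamp (1 - I_val w.2))); split => //= [|t|t].
- apply: (@comp_continuous _ _ _ (fun w => (w.1, I_clamp (1 - I_val w.2)))) => //.
  apply: pair_continuous; first exact: fst_continuous.
  exact: (flip_continuous (@snd_continuous _ _)).
- by rewrite I_val0 subr0 Fq.
- by rewrite I_val1 subrr Fp.
Qed.

Lemma homotopic_trans x y (q p r : {path I from x to y}) :
  homotopic p q -> homotopic q r -> homotopic p r.
Proof.
move=> [F [cF Fp Fq Fx Fy]] [G [cG Gq Gr Gx Gy]].
exists (fun w => concat_fun (fun t => F (w.1, t)) (fun t => G (w.1, t)) w.2).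
split => /= [|s|s|t|t].
- have H (f : I * I -> X) : continuous f ->
    continuous (fun u : (I * I) * I => f (u.1.1, u.2)).
    move=> cf; apply: (@comp_continuous _ _ _ (fun u => (u.1.1, u.2))) => //.
    apply: pair_continuous; last exact: snd_continuous.
    exact: (comp_continuous (@fst_continuous _ _) (@fst_continuous _ _)).
  apply: (@concat_continuous _ snd (fun u => F (u.1.1, u.2)) (fun u => G (u.1.1, u.2))).
  + exact: snd_continuous.
  + exact: H.
  + exact: H.
  + by move=> w /=; rewrite Fq Gq.
- by rewrite /concat_fun I_val0 ifT ?mulr0 ?I_clamp_le0 //; lra.
- rewrite /concat_fun I_val1 ifF ?I_clamp_ge1 //; first by lra.
  by apply/negbTE; lra.
- by rewrite /concat_fun Fx Gx if_same.
- by rewrite /concat_fun Fy Gy if_same.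
Qed.

Lemma homotopic_concat x y z (p p' : {path I from x to y}) (q q' : {path I from y to z}) :
  homotopic p p' -> homotopic q q' -> homotopic (concat p q) (concat p' q').
Proof.
move=> [F [cF Fp Fp' Fx Fy]] [G [cG Gq Gq' Gx Gy]].
exists (fun w => concat_fun (fun s => F (s, w.2)) (fun s => G (s, w.2)) w.1).
split => /= [|s|s|t|t].
- have H (f : I * I -> X) : continuous f ->
    continuous (fun u : (I * I) * I => f (u.2, u.1.2)).
    move=> cf; apply: (@comp_continuous _ _ _ (fun u => (u.2, u.1.2))) => //.
    apply: pair_continuous; first exact: snd_continuous.
    exact: (comp_continuous (@fst_continuous _ _) (@snd_continuous _ _)).
  apply: (@concat_continuous _ fst (fun u => F (u.2, u.1.2)) (fun u => G (u.2, u.1.2))).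
  + exact: fst_continuous.
  + exact: H.
  + exact: H.
  + by move=> w /=; rewrite Fy Gx.
- by rewrite /mk_path /concat_fun Fp Gq.
- by rewrite /mk_path /concat_fun Fp' Gq'.
- by rewrite /concat_fun I_val0 ifT ?mulr0 ?I_clamp_le0 //; lra.
- rewrite /concat_fun I_val1 ifF ?I_clamp_ge1 //; first by lra.
  by apply/negbTE; lra.
Qed.

Lemma homotopic_inverse x y (p q : {path I from x to y}) :
  homotopic p q -> homotopic (inverse p) (inverse q).
Proof.
move=> [F [cF Fp Fq Fx Fy]].
exists (fun w => F (I_clamp (1 - I_val w.1), w.2)); split => /= [|t|t|t|t].
- apply: (@comp_continuous _ _ _ (fun w => (I_clamp (1 - I_val w.1), w.2))) => //.
  apply: pair_continuous; last exact: snd_continuous.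
  exact: (flip_continuous (@fst_continuous _ _)).
- by rewrite Fp.
- by rewrite Fq.
- by rewrite I_val0 I_clamp_ge1 ?subr0.
- by rewrite I_val1 I_clamp_le0 ?subrr.
Qed.

Lemma homotopic_reparam x y a b (p : {path I from x to y}) (phi psi : I -> R)
    (q r : {path I from a to b}) :
  continuous phi -> continuous psi ->
  phi zero = psi zero -> phi one = psi one ->
  (forall t, q t = p (I_clamp (phi t))) ->
  (forall t, r t = p (I_clamp (psi t))) ->
  homotopic q r.
Proof.
move=> cphi cpsi e0 e1 qE rE.
pose u (w : I * I) := phi w.1 + I_val w.2 * (psi w.1 - phi w.1).
exists (fun w => p (I_clamp (u w))); split => [|t|t|t|t].
- apply: (@comp_continuous _ _ _ (fun w => I_clamp (u w))); last exact: cts_fun.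
  have c1 f : continuous f -> continuous (fun w : I * I => f w.1 : R).
    by move=> cf; exact: (comp_continuous (@fst_continuous _ _) cf).
  apply: I_clamp_continuous => w; apply: cvgD; first exact: c1.
  apply: cvgM.
    exact: (I_val_comp_continuous (@snd_continuous _ _)).
  by apply: cvgB; exact: c1.
- by rewrite /u /= I_val0 mul0r addr0 qE.
- by rewrite /u /= I_val1 mul1r addrC subrK rE.
- by rewrite /u /= e0 subrr mulr0 addr0 -e0 -qE path_zero.
- by rewrite /u /= e1 subrr mulr0 addr0 -e1 -qE path_one.
Qed.

End path_operations.

Section group_laws.
Context {R : realType} {X : topologicalType}.
Local Notation I := (unit_interval R).

Lemma homotopic_concatA (x y z w : X) (p : {path I from x to y})
    (q : {path I from y to z}) (r : {path I from z to w}) :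
  homotopic (concat p (concat q r)) (concat (concat p q) r).
Proof.
apply: homotopic_sym.
pose phi (t : I) := Num.min (2 * I_val t)
  (Num.min (I_val t + 4^-1) (2^-1 * (I_val t + 1))).
apply: (@homotopic_reparam _ _ _ _ _ _ (concat p (concat q r)) phi (@I_val R)).
- have cv := @I_val_continuous R.
  apply: min_fun_continuous; first exact: mulc_continuous.
  apply: min_fun_continuous; first exact: addc_continuous.
  by apply: mulc_continuous; exact: addc_continuous.
- exact: I_val_continuous.
- by rewrite /phi I_val0; rewrite !minElt; do !case: ifPn; lra.
- by rewrite /phi I_val1; rewrite !minElt; do !case: ifPn; lra.
- move=> t; have /andP[t0 t1] := I_valP t.
  have t4 : phi t = if I_val t <= 4^-1 then 2 * I_val t else
      if I_val t <= 2^-1 then I_val t + 4^-1 else 2^-1 * (I_val t + 1).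
    by rewrite /phi !minElt; do !case: ifPn; lra.
  rewrite concatE [RHS]concatE !(concatE p q, concatE q r).
  rewrite (@I_val_clamp _ (phi t)); last first.
    by apply/andP; rewrite t4; do !case: ifPn; split; lra.
  rewrite t4; case: (leP (I_val t) 4^-1) => [h1|h1].
    rewrite I_val_clamp; last by apply/andP; lra.
    by rewrite !ifT //; lra.
  case: (leP (I_val t) 2^-1) => h2.
    rewrite I_val_clamp; last by apply/andP; lra.
    rewrite ifF; last by apply/negbTE; lra.
    rewrite ifF; last by apply/negbTE; lra.
    rewrite I_val_clamp; last by apply/andP; lra.
    rewrite ifT; last by lra.
    by congr (q (I_clamp _)); lra.
  rewrite ifF; last by apply/negbTE; lra.
  rewrite I_val_clamp; last by apply/andP; lra.
  rewrite ifF; last by apply/negbTE; lra.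
  by congr (r (I_clamp _)); lra.
- by move=> t; rewrite I_valK.
Qed.

Lemma homotopic_clamp_reparam (x y a b : X) (p : {path I from x to y})
    (phi psi : I -> R) (q r : {path I from a to b}) :
  continuous phi -> continuous psi ->
  I_clamp (phi zero) = I_clamp (psi zero) ->
  I_clamp (phi one) = I_clamp (psi one) ->
  (forall t, q t = p (I_clamp (phi t))) ->
  (forall t, r t = p (I_clamp (psi t))) ->
  homotopic q r.
Proof.
move=> cphi cpsi e0 e1 qE rE.
apply: (@homotopic_reparam _ _ _ _ _ _ p (fun t => I_val (I_clamp (phi t)))
  (fun t => I_val (I_clamp (psi t)))).
- by apply: I_val_comp_continuous; exact: I_clamp_continuous.
- by apply: I_val_comp_continuous; exact: I_clamp_continuous.
- by rewrite e0.
- by rewrite e1.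
- by move=> t; rewrite I_valK.
- by move=> t; rewrite I_valK.
Qed.

Lemma homotopic_concat1p (x y : X) (p : {path I from x to y}) :
  homotopic (concat (constant x) p) p.
Proof.
have cv := @I_val_continuous R.
apply: (@homotopic_clamp_reparam _ _ _ _ p (fun t => 2 * I_val t - 1) (@I_val R)).
- by apply: addc_continuous; exact: mulc_continuous.
- exact: cv.
- by rewrite I_val0 !I_clamp_le0 //; lra.
- by rewrite I_val1 !I_clamp_ge1 //; lra.
- move=> t; rewrite !concatE; case: ifPn => // t2.
  rewrite (_ : I_clamp (2 * I_val t - 1) = zero) ?path_zero //.
  by apply: I_clamp_le0; lra.
- by move=> t; rewrite I_valK.
Qed.

Lemma homotopic_concatp1 (x y : X) (p : {path I from x to y}) :
  homotopic (concat p (constant y)) p.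
Proof.
have cv := @I_val_continuous R.
apply: (@homotopic_clamp_reparam _ _ _ _ p (fun t => 2 * I_val t) (@I_val R)).
- exact: mulc_continuous.
- exact: cv.
- by rewrite I_val0 !I_clamp_le0 //; lra.
- by rewrite I_val1 !I_clamp_ge1 //; lra.
- move=> t; rewrite !concatE; case: ifPn => // t2.
  rewrite (_ : I_clamp (2 * I_val t) = one) ?path_one //.
  by apply: I_clamp_ge1; lra.
- by move=> t; rewrite I_valK.
Qed.

Lemma homotopic_concatpV (x y : X) (p : {path I from x to y}) :
  homotopic (concat p (inverse p)) (constant x).
Proof.
have cv := @I_val_continuous R.
apply: (@homotopic_clamp_reparam _ _ _ _ p
  (fun t => Num.min (2 * I_val t) (2 - 2 * I_val t)) (cst 0)).
- apply: min_fun_continuous; first exact: mulc_continuous.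
  rewrite (_ : (fun t => _) = fun t => -2 * I_val t + 2).
    by apply: addc_continuous; exact: mulc_continuous.
  by apply/funext => t; lra.
- exact: cst_continuous.
- by rewrite I_val0 /= !I_clamp_le0 // minElt; case: ifPn; lra.
- by rewrite I_val1 /= !I_clamp_le0 // minElt; case: ifPn; lra.
- move=> t; rewrite !concatE.
  have /andP[t0 t1] := I_valP t.
  case: (leP (I_val t) 2^-1) => t2.
    by congr (p (I_clamp _)); rewrite minElt; case: ifPn; lra.
  rewrite !inverseE I_val_clamp; last by apply/andP; lra.
  by congr (p (I_clamp _)); rewrite minElt; case: ifPn; lra.
- by move=> t /=; rewrite I_clamp_le0 ?path_zero.
Qed.

Lemma inverseK (x y : X) (p : {path I from x to y}) : inverse (inverse p) = p.
Proof.
apply/path_eqP => t; rewrite !inverseE.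
have /andP[t0 t1] := I_valP t.
rewrite I_val_clamp; last by apply/andP; lra.
by rewrite (_ : 1 - (1 - I_val t) = I_val t) ?I_valK //; lra.
Qed.

Lemma inverse_concat (x y z : X) (p : {path I from x to y})
    (q : {path I from y to z}) :
  inverse (concat p q) = concat (inverse q) (inverse p).
Proof.
apply/path_eqP => t; rewrite inverseE !concatE !inverseE.
have /andP[t0 t1] := I_valP t.
rewrite I_val_clamp; last by apply/andP; lra.
have [t2|t2|t2] := ltgtP (I_val t) 2^-1.
- rewrite ifF; last by apply/negbTE; lra.
  by rewrite I_val_clamp; [congr (q (I_clamp _)); lra|apply/andP; lra].
- rewrite ifT; last by lra.
  by rewrite I_val_clamp; [congr (p (I_clamp _)); lra|apply/andP; lra].
- rewrite ifT; last by lra.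
  rewrite I_val_clamp; last by apply/andP; lra.
  by rewrite I_clamp_ge1 ?path_one ?I_clamp_le0 ?path_zero //; lra.
Qed.

Lemma homotopic_concatVp (x y : X) (p : {path I from x to y}) :
  homotopic (concat (inverse p) p) (constant y).
Proof. by rewrite -{2}[p]inverseK; exact: homotopic_concatpV. Qed.

End group_laws.

Section fundamental_group.
Context (R : realType) {X : topologicalType} (x : X).
Local Notation I := (unit_interval R).
Local Notation loop := {path I from x to x}.

Definition homotopicb (p q : loop) : bool := `[< homotopic p q >].

Lemma homotopicb_refl : reflexive homotopicb.
Proof. by move=> p; apply/asboolP; exact: homotopic_refl. Qed.

Lemma homotopicb_sym : symmetric homotopicb.
Proof. by move=> p q; apply/asboolP/asboolP; exact: homotopic_sym. Qed.

Lemma homotopicb_trans : transitive homotopicb.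
Proof.
by move=> q p r /asboolP pq /asboolP qr; apply/asboolP; exact: homotopic_trans qr.
Qed.

Canonical homotopicb_equiv :=
  EquivRel homotopicb homotopicb_refl homotopicb_sym homotopicb_trans.

(* The library gives the type of loops the compact-open topology, so that pi1 *)
(* carries the topology for which pi1_class is a quotient map.                *)
Definition pi1 : Type := {eq_quot homotopicb}.

HB.instance Definition _ := Topological.copy pi1 (quotient_topology pi1).
HB.instance Definition _ := Quotient.on pi1.

Definition pi1_class (p : loop) : pi1 := \pi p.

Lemma pi1_classP (p q : loop) : pi1_class p = pi1_class q <-> homotopic p q.
Proof. by split=> [/eqmodP/asboolP//|pq]; apply/eqmodP/asboolP. Qed.

Definition pi1_mul (a b : pi1) : pi1 := pi1_class (concat (repr a) (repr b)).
Definition pi1_one : pi1 := pi1_class (constant x).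
Definition pi1_inv (a : pi1) : pi1 := pi1_class (inverse (repr a)).

Lemma repr_pi1_class (p : loop) : homotopic (repr (pi1_class p)) p.
Proof. by apply/pi1_classP; exact: reprK. Qed.

Lemma pi1_classE (a : pi1) : exists p, a = pi1_class p.
Proof. by exists (repr a); rewrite /pi1_class reprK. Qed.

Lemma pi1_mulE p q : pi1_mul (pi1_class p) (pi1_class q) = pi1_class (concat p q).
Proof. by apply/pi1_classP; apply: homotopic_concat; exact: repr_pi1_class. Qed.

Lemma pi1_invE p : pi1_inv (pi1_class p) = pi1_class (inverse p).
Proof. by apply/pi1_classP; apply: homotopic_inverse; exact: repr_pi1_class. Qed.

Lemma pi1_mulA : associative pi1_mul.
Proof.
move=> a b c; have [[p ->] [[q ->] [r ->]]] :=
  (pi1_classE a, (pi1_classE b, pi1_classE c)).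
by rewrite !pi1_mulE; apply/pi1_classP; exact: homotopic_concatA.
Qed.

Lemma pi1_mul1g : left_id pi1_one pi1_mul.
Proof.
move=> a; have [p ->] := pi1_classE a.
by rewrite pi1_mulE; apply/pi1_classP; exact: homotopic_concat1p.
Qed.

Lemma pi1_mulg1 : right_id pi1_one pi1_mul.
Proof.
move=> a; have [p ->] := pi1_classE a.
by rewrite pi1_mulE; apply/pi1_classP; exact: homotopic_concatp1.
Qed.

Lemma pi1_mulVg : left_inverse pi1_one pi1_inv pi1_mul.
Proof.
move=> a; have [p ->] := pi1_classE a.
by rewrite pi1_invE pi1_mulE; apply/pi1_classP; exact: homotopic_concatVp.
Qed.

Lemma pi1_mulgV : right_inverse pi1_one pi1_inv pi1_mul.
Proof.
move=> a; have [p ->] := pi1_classE a.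
by rewrite pi1_invE pi1_mulE; apply/pi1_classP; exact: homotopic_concatpV.
Qed.

HB.instance Definition _ := isGroup.Build pi1
  pi1_mulA pi1_mul1g pi1_mulg1 pi1_mulVg pi1_mulgV.

Lemma pi1_openE (A : set pi1) : open A <-> open (pi1_class @^-1` A).
Proof. by []. Qed.

Lemma pi1_class_big n (f : 'I_n -> loop) :
  pi1_class (\big[concat/constant x]_(j < n) f j) =
  (\prod_(j < n) pi1_class (f j))%g.
Proof. by apply: (big_morph pi1_class) => // p q; rewrite -pi1_mulE. Qed.

(* P(X, x), the paths starting at x with arbitrary endpoint *)
Definition path_from : Type := {y : X & {path I from x to y}}.

Definition endpoint (u : path_from) : X := tag u.

Definition path_open_cover (V : path_from -> set X) : Prop :=
  [/\ forall u, open (V u), \bigcup_u V u = setT & forall u, V u (endpoint u)].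

(* u v u^-1 *)
Definition lasso (u : path_from) (v : {path I from endpoint u to endpoint u}) :
    loop :=
  concat (concat (tagged u) v) (inverse (tagged u)).

(* Each product of loops is parenthesized to the right and ends with the      *)
(* constant loop, which does not change its homotopy class.                   *)
Definition path_spanier (V : path_from -> set X) : set pi1 :=
  [set g | exists (n : nat) (u : 'I_n -> path_from)
      (v : forall j, {path I from endpoint (u j) to endpoint (u j)}),
    (forall j, range (v j) `<=` V (u j)) /\
    g = pi1_class (\big[concat/constant x]_(j < n) lasso (v j))].

Let based := {u : path_from & {path I from endpoint u to endpoint u}}.

Lemma path_spanierP (V : path_from -> set X) (g : pi1) :
  path_spanier V g <->
  exists2 s : seq based, (forall w, w \in s -> range (tagged w) `<=` V (tag w)) &
    g = (\prod_(w <- s) pi1_class (lasso (tagged w)))%g.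
Proof.
split=> [[n [u [v [vV ->]]]]|[s sV ->]].
  exists [seq Tagged _ (v j) : based | j <- index_enum 'I_n].
    by move=> _ /mapP[j _ ->]; exact: vV.
  by rewrite big_map pi1_class_big.
exists (size s), (fun j => tag (tnth (in_tuple s) j)),
  (fun j => tagged (tnth (in_tuple s) j)); split.
  by move=> j; apply: sV; exact: mem_tnth.
by rewrite pi1_class_big big_tnth.
Qed.

Lemma pi1_class_lassoV u (v : {path I from endpoint u to endpoint u}) :
  ((pi1_class (lasso v))^-1)%g = pi1_class (lasso (inverse v)).
Proof.
rewrite [LHS]pi1_invE; apply/pi1_classP.
by rewrite /lasso !inverse_concat inverseK; exact: homotopic_concatA.
Qed.

Lemma range_inverse (y z : X) (p : {path I from y to z}) :
  range (inverse p) `<=` range p.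
Proof. by move=> _ [t _ <-]; rewrite inverseE; exists (I_clamp (1 - I_val t)). Qed.

Lemma path_spanier_closed (V : path_from -> set X) :
  group_closed (mem (path_spanier V)).
Proof.
have V1 : path_spanier V 1%g.
  by apply/path_spanierP; exists [::]; rewrite ?big_nil.
have VM g h : path_spanier V g -> path_spanier V h -> path_spanier V (g * h)%g.
  move=> /path_spanierP[s sV ->] /path_spanierP[t tV ->].
  apply/path_spanierP; exists (s ++ t); last by rewrite big_cat.
  by move=> w; rewrite mem_cat => /orP[/sV|/tV].
have VV g : path_spanier V g -> path_spanier V (g^-1)%g.
  move=> /path_spanierP[s sV ->]; elim: s sV => [|w s IH] sV.
    by rewrite big_nil invg1.
  rewrite big_cons invgM; apply: VM.
    by apply: IH => w' w's; apply: sV; rewrite inE w's orbT.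
  rewrite pi1_class_lassoV; apply/path_spanierP.
  exists [:: Tagged _ (inverse (tagged w)) : based]; last by rewrite big_seq1.
  move=> _ /[!inE] /eqP -> /=; apply: subset_trans (@range_inverse _ _ _) _.
  by apply: sV; rewrite inE eqxx.
split; first exact/mem_set.
by move=> g h /set_mem gV /set_mem hV; apply/mem_set/VM => //; exact: VV.
Qed.

End fundamental_group.

Section local_path_connectedness.
Context (R : realType) (X : topologicalType).

Definition path_connected (A : set X) : Prop :=
  forall a b, A a -> A b ->
    exists p : {path unit_interval R from a to b}, range p `<=` A.

Definition locally_path_connected : Prop :=
  forall (x : X) (U : set X), nbhs x U ->
    exists V : set X, [/\ open V, V x, V `<=` U & path_connected V].

End local_path_connectedness.

(* Main.v *)
(* If H is open, the nullhomotopic loop u u^-1 has a compact-open neighborhood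
   of loops with classes in H, which contains u v u^-1 for every loop v in a
   small neighborhood of u(1); these neighborhoods, enlarged by the points not
   reachable from x, form the path open cover.

   Conversely, fix a loop a with class in H, and for s in [0, 1] consider the
   property that [b_s g^-1 a_s^-1] lies in H for all loops b near a and all
   paths g from a(s) to b(s) near a(s), where a_s, b_s are the restrictions
   to [0, s]. By local path connectedness this property is locally constant in
   s: moving from s to a nearby t multiplies the class by that of a_s v a_s^-1
   with v a loop in the member of the cover indexed by a_s. It holds at s = 0,
   hence at s = 1 since [0, 1] is connected, where it gives [b a^-1] in H. *)
Require Import Defs.
From mathcomp Require Import all_boot all_order all_algebra.
From mathcomp Require Import all_classical all_reals.
From mathcomp Require Import topology normedtype homotopy.
From mathcomp Require Import lra.
From Corelib Require Setoid.

Set Implicit Arguments.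
Unset Strict Implicit.
Unset Printing Implicit Defensive.

Import Order.TTheory GRing.Theory Num.Theory.
Import numFieldNormedType.Exports.

Local Open Scope classical_set_scope.
Local Open Scope ring_scope.

(** * Cancellation up to homotopy *)

Section homotopy_calculus.
Context {R : realType} {X : topologicalType}.
Local Notation I := (unit_interval R).

#[local] Instance homotopic_equivalence (x y : X) :
  RelationClasses.Equivalence (@homotopic R X x y).
Proof.
split.
- by move=> p; exact: homotopic_refl.
- by move=> p q; exact: homotopic_sym.
- by move=> p q r; exact: homotopic_trans.
Qed.

#[local] Hint Resolve homotopic_refl : core.

#[local] Instance concat_proper (x y z : X) :
  Morphisms.Proper
    (Morphisms.respectful (@homotopic R X x y)
      (Morphisms.respectful (@homotopic R X y z) (@homotopic R X x z)))
    (@concat R X x y z).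
Proof. by move=> p p' pp' q q' qq'; exact: homotopic_concat. Qed.

#[local] Instance inverse_proper (x y : X) :
  Morphisms.Proper
    (Morphisms.respectful (@homotopic R X x y) (@homotopic R X y x))
    (@inverse R X x y).
Proof. by move=> p p' pp'; exact: homotopic_inverse. Qed.

Lemma homotopic_concatKVp (x y z : X) (p : {path I from x to y})
    (q : {path I from y to z}) :
  homotopic (concat (inverse p) (concat p q)) q.
Proof. by rewrite homotopic_concatA homotopic_concatVp homotopic_concat1p. Qed.

(** On the right [inverse a] meets [a], after which [inverse g] meets [g]; both pairs cancel. This
    compares two times: [a] and [b] run up to the first, [d] and [c] continue to the second, and
    [g], [k] bridge their ends. *)
Lemma homotopic_lasso_shift (x y z y' z' : X)
    (a : {path I from x to y}) (b : {path I from x to z})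
    (d : {path I from y to y'}) (c : {path I from z to z'})
    (g : {path I from y to z}) (k : {path I from y' to z'}) :
  homotopic
    (concat (concat (concat b c) (inverse k)) (inverse (concat a d)))
    (concat (concat (concat b (inverse g)) (inverse a))
      (concat (concat a (concat (concat (concat g c) (inverse k)) (inverse d)))
        (inverse a))).
Proof.
rewrite inverse_concat -!homotopic_concatA.
by rewrite homotopic_concatKVp homotopic_concatKVp.
Qed.

End homotopy_calculus.

(** * Segments, compactness and connectedness of the unit interval *)

Section segments.
Context {R : realType}.
Local Notation I := (unit_interval R).

(** [t] may lie on either side of [s]; the segment then runs backwards, so no order on times is
    needed later. *)
Definition between (s t r : I) : I :=
  I_clamp (I_val s + I_val r * (I_val t - I_val s)).

Lemma between_itv (a b r : R) : 0 <= a <= 1 -> 0 <= b <= 1 -> 0 <= r <= 1 ->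
  0 <= a + r * (b - a) <= 1.
Proof. by move=> /andP[? ?] /andP[? ?] /andP[? ?]; apply/andP; split; nra. Qed.

Lemma I_val_between (s t r : I) :
  I_val (between s t r) = I_val s + I_val r * (I_val t - I_val s).
Proof. by rewrite I_val_clamp // between_itv //; exact: I_valP. Qed.

Lemma between0 (s t : I) : between s t zero = s.
Proof. by apply: I_val_inj; rewrite I_val_between I_val0 mul0r addr0. Qed.

Lemma between1 (s t : I) : between s t one = t.
Proof. by apply: I_val_inj; rewrite I_val_between I_val1 mul1r addrC subrK. Qed.

Lemma between_continuous (s t : I) : continuous (between s t).
Proof.
apply: I_clamp_continuous; under eq_fun do rewrite addrC mulrC.
by apply: addc_continuous; apply: mulc_continuous; exact: I_val_continuous.
Qed.

Lemma I_clamp_cts : continuous (@I_clamp R).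
Proof. by apply: (@I_clamp_continuous R R id) => r; exact: cvg_id. Qed.

(** The preimage of [A] under [I_clamp] contains a real ball around [I_val s], and balls are
    convex. *)
Lemma near_between (s : I) (A : set I) : nbhs s A ->
  \forall t \near s, range (between s t) `<=` A.
Proof.
move=> sA; have : nbhs (I_val s) (@I_clamp R @^-1` A).
  by apply: I_clamp_cts; rewrite I_valK.
move=> /nbhs_ballP[e /= e0 eA].
have : nbhs s (@I_val R @^-1` ball (I_val s) e).
  by apply: I_val_continuous; exact: nbhsx_ballx.
apply: filterS => t /= st _ [r _ <-].
apply: eA; move: st; rewrite /ball /= opprD addNKr normrN normrM distrC.
apply: le_lt_trans; have /andP[r0 r1] := I_valP r.
by rewrite ger0_norm // ler_piMl.
Qed.

Lemma unit_interval_range_clamp : [set: I] = @I_clamp R @` `[0, 1].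
Proof.
apply/seteqP; split => // t _; exists (I_val t); last exact: I_valK.
by rewrite /= in_itv /= I_valP.
Qed.

Lemma unit_interval_compact : compact [set: I].
Proof.
rewrite unit_interval_range_clamp; apply: continuous_compact.
  by apply: continuous_subspaceT; exact: I_clamp_cts.
exact: segment_compact.
Qed.

Lemma unit_interval_connected : connected [set: I].
Proof.
rewrite unit_interval_range_clamp; apply: connected_continuous_connected.
  exact: segment_connected.
by apply: continuous_subspaceT; exact: I_clamp_cts.
Qed.

Lemma between_compact (s t : I) : compact (range (between s t)).
Proof.
apply: continuous_compact; last exact: unit_interval_compact.
by apply: continuous_subspaceT; exact: between_continuous.
Qed.

End segments.

(** Local constancy makes both [P] and its complement open. *)
Lemma connected_locally_constant (T : topologicalType) (P : set T) (a b : T) :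
  connected [set: T] -> (forall s, \forall t \near s, P s <-> P t) ->
  P a -> P b.
Proof.
move=> cT nP Pa; suff -> : P = setT by [].
apply: cT; first by exists a.
- exists P; last by rewrite setTI.
  rewrite openE => s Ps; apply: filterS (nP s) => t [+ _]; exact.
- exists P; last by rewrite setTI.
  rewrite -openC openE => s Ps; apply: filterS (nP s) => t [_ +] Pt.
  by move=> /(_ Pt).
Qed.

(** * Subpaths and their concatenation *)

Section subpaths.
Context {R : realType} {X : topologicalType} {x y : X}.
Local Notation I := (unit_interval R).
Implicit Types p : {path I from x to y}.

Section subpath.
Context p (s t : I) (z w : X) (pz : p s = z) (pw : p t = w).

Let subpath_fun (r : I) : X := p (between s t r).

Let subpath_continuous : continuous subpath_fun.
Proof.
by apply: (comp_continuous (@between_continuous _ s t)); exact: cts_fun.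
Qed.

Let subpath_zero : subpath_fun zero = z.
Proof. by rewrite /subpath_fun between0. Qed.

Let subpath_one : subpath_fun one = w.
Proof. by rewrite /subpath_fun between1. Qed.

(** Endpoints enter through equations, so that a segment starting at [zero] can be typed as starting
    at [x] and composes without transport. *)
Definition subpath : {path I from z to w} :=
  mk_path subpath_continuous subpath_zero subpath_one.

Lemma subpathE r : subpath r = p (between s t r).
Proof. by []. Qed.

End subpath.

Lemma subpath_full p : subpath (@path_zero _ _ _ _ p) (@path_one _ _ _ _ p) = p.
Proof.
apply/path_eqP => r; rewrite subpathE; congr (p _); apply: I_val_inj.
by rewrite I_val_between I_val0 I_val1 subr0 mulr1 add0r.
Qed.

(** Both sides reparametrize [p]: [phi] goes straight from [s] to [u], [psi] goes through [t].
    Agreement at the ends suffices, whatever the order of the three times. *)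
Lemma homotopic_subpath_concat p (s t u : I) (z w v : X) (pz : p s = z)
    (pw : p t = w) (pv : p u = v) :
  homotopic (subpath pz pv) (concat (subpath pz pw) (subpath pw pv)).
Proof.
pose phi (r : I) : R := I_val s + I_val r * (I_val u - I_val s).
pose f (r : I) : R := I_val s + 2 * I_val r * (I_val t - I_val s).
pose g (r : I) : R := I_val t + (2 * I_val r - 1) * (I_val u - I_val t).
pose psi (r : I) : R := if I_val r <= 2^-1 then f r else g r.
have affine (c d e h : R) : continuous (fun r : I => c + (d * I_val r + e) * h).
  under eq_fun do rewrite addrC mulrC.
  apply: addc_continuous; apply: mulc_continuous; apply: addc_continuous.
  by apply: mulc_continuous; exact: I_val_continuous.
apply: (@homotopic_reparam _ _ _ _ _ _ p phi psi).
- by have := affine (I_val s) 1 0 (I_val u - I_val s);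
    under eq_fun do rewrite mul1r addr0.
- apply: glue_continuous.
  + exact: I_val_continuous.
  + exact: cst_continuous.
  + by have := affine (I_val s) 2 0 (I_val t - I_val s);
      under eq_fun do rewrite addr0.
  + exact: affine.
  + by move=> r e; rewrite /f /g e; lra.
- by rewrite /phi /psi /f I_val0 ifT; lra.
- by rewrite /phi /psi /g I_val1 ifF; [lra|apply/negbTE; lra].
- by move=> r; rewrite subpathE.
- move=> r; rewrite concatE /psi; have /andP[r0 r1] := I_valP r.
  case: ifPn => hr; rewrite subpathE /between I_val_clamp //.
    by apply/andP; lra.
  by apply/andP; lra.
Qed.

Lemma near_subpath_range p (s : I) (U : set X) : open U -> U (p s) ->
  \forall t \near s, range (p \o between s t) `<=` U.
Proof.
move=> oU Us; have : nbhs s (p @^-1` U).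
  by apply: (@cts_fun _ _ p s); exact: open_nbhs_nbhs.
move=> /near_between; apply: filterS => t sU _ [r _ <-] /=.
by apply: sU; exists r.
Qed.

End subpaths.

(** * Ranges of paths and compact-open neighborhoods *)

Section ranges.
Context {R : realType} {X : topologicalType}.
Local Notation I := (unit_interval R).

Lemma range_concat (x y z : X) (p : {path I from x to y})
    (q : {path I from y to z}) (U : set X) :
  range p `<=` U -> range q `<=` U -> range (concat p q) `<=` U.
Proof.
by move=> pU qU _ [t _ <-]; rewrite concatE; case: ifP => _;
  [apply: pU|apply: qU]; eexists.
Qed.

Lemma range_inverse_sub (x y : X) (p : {path I from x to y}) (U : set X) :
  range p `<=` U -> range (inverse p) `<=` U.
Proof. by move=> pU; apply: subset_trans pU; exact: range_inverse. Qed.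

Lemma path_nbhs_compact_open (x y : X) (p : {path I from x to y}) (K : set I)
    (U : set X) : compact K -> open U -> p @` K `<=` U ->
  nbhs p [set q : {path I from x to y} | q @` K `<=` U].
Proof.
move=> cK oU pU; apply: open_nbhs_nbhs; split=> //.
by exists [set f | f @` K `<=` U] => //; exact: compact_open_open.
Qed.

End ranges.

(** * Lassos with a small loop *)

Section fundamental_group_topology.
Context {R : realType} {X : topologicalType} {x : X}.
Local Notation I := (unit_interval R).
Local Notation loop := {path I from x to x}.

(** The legs of a lasso are traversed at times independent of its loop, so [t] falls either on a leg
    along [u] or its inverse, or on the loop at one common parameter [s]. *)
Lemma lassoE (u : path_from R x) (v : {path I from endpoint u to endpoint u})
    (t : I) :
  (forall w : {path I from endpoint u to endpoint u},
    lasso w t = lasso v t) \/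
  exists s, forall w : {path I from endpoint u to endpoint u},
    lasso w t = w s.
Proof.
rewrite /lasso !concatE; case: (leP (I_val t) 2^-1) => t2; last first.
  by left=> w; rewrite !concatE ifF //; apply/negbTE; rewrite -ltNge.
set s := I_clamp _; case: (leP (I_val s) 2^-1) => s2.
  by left=> w; rewrite !concatE t2 -/s s2.
right; exists (I_clamp (2 * I_val s - 1)) => w.
by rewrite !concatE t2 -/s ifF //; apply/negbTE; rewrite -ltNge.
Qed.

Lemma lasso_nbhs (u : path_from R x) (A : set loop) :
  nbhs (lasso (Defs.constant (endpoint u))) A ->
  exists O, [/\ open O, O (endpoint u) &
    forall v : {path I from endpoint u to endpoint u},
      range v `<=` O -> A (lasso v)].
Proof.
set y := endpoint u; set c := Defs.constant y.
(* lasso v tends to lasso c as the range of v shrinks to y: on the part of    *)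
(* the interval running along v, lasso c is constantly y, so a compact-open   *)
(* constraint that matters there already contains y.                          *)
pose F : set_system {compact-open, I -> X} :=
  filter_from [set O | open O /\ O y]
    (fun O => [set f : {compact-open, I -> X} |
      exists2 v : {path I from y to y}, range v `<=` O & f = lasso v :> (I -> X)]).
have FF : Filter F.
  apply: filter_from_filter; first by exists setT; split => //; exact: openT.
  move=> O O' [oO Oy] [oO' Oy']; exists (O `&` O').
    by split; [exact: openI|].
  move=> _ [v vO ->]; split; exists v => //.
    by move=> z /vO [].
  by move=> z /vO [].
have Fc : F --> (lasso c : {compact-open, I -> X}).
  apply/compact_open_cvgP => K O cK oO cO.
  exists (if `[< O y >] then O else setT).
    by case: asboolP => Oy; split => //; exact: openT.
  move=> _ [v vO ->] _ [t Kt <-].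
  have [cE|[s vE]] := lassoE c t.
    by rewrite cE; apply: cO; exists t.
  have Oy : O y by have := cO _ (ex_intro2 _ _ t Kt erefl); rewrite vE.
  by move: vO; rewrite asboolT // => vO; rewrite vE; apply: vO; exists s.
move=> [_ [[B oB <-] Bc BA]].
have [|O [oO Oy] OB] := Fc B; first exact: open_nbhs_nbhs.
exists O; split => // v vO; apply: BA; apply: OB; exists v => //.
Qed.

(** Inside a path connected neighborhood of [y], a path to any of its points extends to [y]. *)
Lemma open_unreachable : locally_path_connected R X ->
  open [set y | ~ exists p : {path I from x to y}, True].
Proof.
move=> lX; rewrite openE => y Wy.
have [V [oV Vy _ pV]] := lX y setT filterT.
apply: filterS (open_nbhs_nbhs (conj oV Vy)) => z Vz [p _]; apply: Wy.
by have [q _] := pV z y Vz Vy; exists (concat p q).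
Qed.

(** * Membership in a fixed subgroup *)

Variable H : set (pi1 R x).
Hypothesis hH : group_closed (mem H).

Lemma subgroup1 : H 1%g.
Proof. by case: hH => /set_mem. Qed.

Lemma subgroup_div a b : H a -> H b -> H (a / b)%g.
Proof. by case: hH => _ h /mem_set Ha /mem_set Hb; apply/set_mem/h. Qed.

Lemma subgroup_mul a b : H a -> H b -> H (a * b)%g.
Proof.
move=> Ha Hb; rewrite -[b]invgK; apply: subgroup_div => //.
by rewrite -[(b^-1)%g]mul1g; apply: subgroup_div => //; exact: subgroup1.
Qed.

Lemma subgroup_mulr a b : H b -> H (a * b)%g <-> H a.
Proof.
move=> Hb; split=> [Hab|Ha]; last exact: subgroup_mul.
by rewrite -[a](mulgK b); exact: subgroup_div.
Qed.

Lemma path_spanier_sub (V : path_from R x -> set X) :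
  (forall u (v : {path I from endpoint u to endpoint u}),
    range v `<=` V u -> H (pi1_class (lasso v))) ->
  path_spanier V `<=` H.
Proof.
move=> VH g /path_spanierP[s sV ->].
elim: s sV => [|w s IH] sV; first by rewrite big_nil; exact: subgroup1.
rewrite big_cons; apply: subgroup_mul.
  by apply: VH; apply: sV; rewrite inE eqxx.
by apply: IH => w' w's; apply: sV; rewrite inE w's orbT.
Qed.

Lemma path_spanier_lasso (V : path_from R x -> set X) u
    (v : {path I from endpoint u to endpoint u}) :
  range v `<=` V u -> path_spanier V (pi1_class (lasso v)).
Proof.
move=> vV; exists 1, (fun=> u), (fun=> v); split => //.
by rewrite pi1_class_big big_ord1.
Qed.

(** * From an open subgroup to a path open cover *)

Lemma open_path_spanier : locally_path_connected R X -> open H ->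
  exists V : path_from R x -> set X,
    path_open_cover V /\ path_spanier V `<=` H.
Proof.
move=> lX /pi1_openE; rewrite openE => oH.
have lassoH (u : path_from R x) : exists O, [/\ open O, O (endpoint u) &
    forall v : {path I from endpoint u to endpoint u},
      range v `<=` O -> H (pi1_class (lasso v))].
  apply: (@lasso_nbhs u (@pi1_class R X x @^-1` H)); apply: oH => /=.
  (* The lasso on a constant loop is homotopic to [u] followed by its inverse. *)
  rewrite (_ : pi1_class _ = 1%g); first exact: subgroup1.
  apply/pi1_classP; apply: homotopic_trans (homotopic_concatpV (tagged u)).
  by apply: homotopic_concat; [exact: homotopic_concatp1|exact: homotopic_refl].
have [O OP] := choice lassoH.
pose W := [set y | ~ exists p : {path I from x to y}, True].
(* O only covers the path component of x; W covers the rest of X and meets no *)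
(* loop based at the end of a path from x.                                    *)
exists (fun u => O u `|` W); split.
  split=> [u||u].
  - by apply: openU; [case: (OP u)|exact: open_unreachable].
  - apply/seteqP; split => // y _.
    have [[p _]|Wy] := pselect (exists p : {path I from x to y}, True).
      by exists (existT _ y p) => //; left; case: (OP (existT _ y p)).
    by exists (existT _ x (Defs.constant x)) => //; right.
  - by left; case: (OP u).
apply: path_spanier_sub => u v vOW; case: (OP u) => _ _; apply => _ [t _ <-].
have [//|[]] : (O u `|` W) (v t) by apply: vOW; exists t.
(* Following [u] and then [v] up to time [t] reaches [v t], which excludes [W]. *)
exists (concat (tagged u)
  (subpath (@path_zero _ _ _ _ v) (erefl (v t)))) => //.
Qed.

(** * From a path open cover to openness, through deviations *)

Definition initial_segment (a : loop) (s : I) (y : X) (ay : a s = y) :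
    path_from R x :=
  existT _ y (subpath (@path_zero _ _ _ _ a) ay).

(* With a_s, b_s the restrictions of a and b to [0, s] and g a bridge from     *)
(* a(s) to b(s), this is the loop b_s g^-1 a_s^-1.                            *)
Definition deviation (a b : loop) (s : I) (y z : X) (ay : a s = y)
    (bz : b s = z) (g : {path I from y to z}) : loop :=
  concat (concat (subpath (@path_zero _ _ _ _ b) bz) (inverse g))
    (inverse (subpath (@path_zero _ _ _ _ a) ay)).

(** At time zero both restrictions are constant at [x], so [g] is itself a loop and its inverse
    serves as [v]. *)
Lemma deviation_zero (a b : loop) (y z : X) (ay : a zero = y)
    (bz : b zero = z) (g : {path I from y to z}) :
  exists v : {path I from y to y},
    range v `<=` range g /\
    deviation ay bz g = lasso (u := initial_segment ay) v.
Proof.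
have yx : y = x by rewrite -ay path_zero.
have zx : z = x by rewrite -bz path_zero.
move: ay bz g; rewrite yx zx => ay bz g.
exists (inverse g); split; first exact: range_inverse.
rewrite /deviation /lasso /=; congr (concat (concat _ _) _).
have between00 r : between zero zero r = zero :> I.
  by apply: I_val_inj; rewrite I_val_between subrr mulr0 addr0.
by apply/path_eqP => r; rewrite !subpathE between00 !path_zero.
Qed.

Lemma deviation_one (a b : loop) (ax : a one = x) (bx : b one = x) :
  pi1_class (deviation ax bx (Defs.constant x)) =
  (pi1_class b / pi1_class a)%g.
Proof.
rewrite (Prop_irrelevance ax (@path_one _ _ _ _ a)).
rewrite (Prop_irrelevance bx (@path_one _ _ _ _ b)).
rewrite /deviation !subpath_full [(_^-1)%g]pi1_invE [RHS]pi1_mulE.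
apply/pi1_classP/homotopic_concat; last exact: homotopic_refl.
rewrite (_ : inverse _ = Defs.constant x); first exact: homotopic_concatp1.
by apply/path_eqP => r.
Qed.

(* If the bridges and both segments between s and t stay in U, the deviations *)
(* at s and t differ by a lasso on a_s whose loop lies in U.                  *)
Lemma deviation_shift (a b : loop) (s t : I) (y z y' z' : X)
    (ay : a s = y) (bz : b s = z) (ay' : a t = y') (bz' : b t = z')
    (g : {path I from y to z}) (k : {path I from y' to z'}) (U : set X) :
  range (a \o between s t) `<=` U -> range (b \o between s t) `<=` U ->
  range g `<=` U -> range k `<=` U ->
  (forall v : {path I from y to y}, range v `<=` U ->
    H (pi1_class (lasso (u := initial_segment ay) v))) ->
  H (pi1_class (deviation ay bz g)) <-> H (pi1_class (deviation ay' bz' k)).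
Proof.
move=> aU bU gU kU HU.
pose d := subpath ay ay'; pose c := subpath bz bz'.
pose v := concat (concat (concat g c) (inverse k)) (inverse d).
have Hv : H (pi1_class (lasso (u := initial_segment ay) v)).
  by apply: HU; do 3?[apply: range_concat => //]; exact: range_inverse_sub.
rewrite -(subgroup_mulr (pi1_class (deviation ay bz g)) Hv) [(_ * _)%g]pi1_mulE.
rewrite (_ : pi1_class (concat _ _) = pi1_class (deviation ay' bz' k)) //.
apply/pi1_classP; apply: homotopic_sym.
apply: homotopic_trans (homotopic_lasso_shift _ _ d c g k).
apply: homotopic_concat.
  apply: homotopic_concat; last exact: homotopic_refl.
  exact: homotopic_subpath_concat.
by apply: homotopic_inverse; exact: homotopic_subpath_concat.
Qed.

Lemma path_spanier_open (V : path_from R x -> set X) :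
  locally_path_connected R X -> path_open_cover V -> path_spanier V `<=` H ->
  open H.
Proof.
move=> lX [oV _ Vu] VH; apply/pi1_openE; rewrite openE => a Ha.
(* [N] and [O] may depend on [s]. Quantifying over [y] and [z] allows both to be [x] at the final
   time. *)
pose P (s : I) := exists N O, [/\ nbhs a N, open O, O (a s) &
  forall (b : loop) y z (ay : a s = y) (bz : b s = z) (g : {path I from y to z}),
    N b -> range g `<=` O -> H (pi1_class (deviation ay bz g))].
pose u (s : I) := initial_segment (erefl (a s)).
have VuH s (O : set X) y (ay : a s = y) (v : {path I from y to y}) :
    O `<=` V (u s) -> range v `<=` O ->
    H (pi1_class (lasso (u := initial_segment ay) v)).
  case: y / ay v => v OV vO; apply: VH; apply: path_spanier_lasso.
  exact: subset_trans OV.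
have P0 : P zero.
  exists setT, (V (u zero)); split; [exact: filterT|exact: oV|exact: Vu|].
  move=> b y z ay bz g _ gV; have [v [vg ->]] := deviation_zero ay bz g.
  by apply: (VuH _ _ _ _ _ (@subset_refl _ _)); exact: subset_trans gV.
have Pnear s : \forall t \near s, P s <-> P t.
  have [U [oU Us UV pU]] := lX _ _ (open_nbhs_nbhs (conj (oV (u s)) (Vu (u s)))).
  apply: filterS (near_subpath_range oU Us) => t aU.
  have Ut : U (a t).
    by apply: aU; exists one => //=; rewrite between1.
  have nN : nbhs a [set b : loop | range (b \o between s t) `<=` U].
    apply: filterS (path_nbhs_compact_open (@between_compact _ s t) oU _).
      by move=> b /=; rewrite image_comp.
    by rewrite image_comp.
  have nbhs_at r (O : set X) : open O -> O (a r) ->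
      nbhs a [set b : loop | O (b r)].
    move=> oO Or; apply: filterS (path_nbhs_compact_open (K := [set r]) _ oO _).
    - by move=> b /= bO; apply: bO; exists r.
    - exact: compact_set1.
    - by move=> _ [_ -> <-].
  (* Knowledge at one time is used through a bridge there: shrinking [N] puts the point of [b] at
     that time into [O'], whose path connectedness gives a bridge inside both [O] and [U]. In both
     directions the correcting lasso rides on the restriction of [a] to [[0, s]], so [V (u s)]
     controls it for every such [t]. *)
  split=> -[N [O [aN oO Oa NO]]].
  - have [O' [oO' O'a O'O pO']] : exists O', [/\ open O', O' (a s),
        O' `<=` O `&` U & path_connected R O'].
      by apply: lX; apply: filterI; exact: open_nbhs_nbhs.
    exists (N `&` [set b : loop | range (b \o between s t) `<=` U] `&`
      [set b : loop | O' (b s)]), U; split => //.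
      by apply: filterI; [exact: filterI|exact: nbhs_at].
    move=> b y z ay bz k [[Nb bU] O'b] kU.
    have [g gO'] := pO' _ _ O'a O'b.
    have gOU := subset_trans gO' O'O.
    apply/(@deviation_shift a b s t _ _ _ _ (erefl _) (erefl _) ay bz g k U);
      rewrite //.
    + by move=> ? /gOU[].
    + by move=> v; exact: VuH.
    + by apply: NO => // ? /gOU[].
  - have [O' [oO' O'a O'O pO']] : exists O', [/\ open O', O' (a t),
        O' `<=` O `&` U & path_connected R O'].
      by apply: lX; apply: filterI; exact: open_nbhs_nbhs.
    exists (N `&` [set b : loop | range (b \o between s t) `<=` U] `&`
      [set b : loop | O' (b t)]), U; split => //.
      by apply: filterI; [exact: filterI|exact: nbhs_at].
    move=> b y z ay bz g [[Nb bU] O'b] gU.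
    have [k kO'] := pO' _ _ O'a O'b.
    have kOU := subset_trans kO' O'O.
    apply/(@deviation_shift a b s t _ _ _ _ ay bz (erefl _) (erefl _) g k U);
      rewrite //.
    + by move=> ? /kOU[].
    + by move=> v; exact: VuH.
    + by apply: NO => // ? /kOU[].
have [N [O [aN oO Oa NO]]] : P one.
  exact: (@connected_locally_constant I P zero one (@unit_interval_connected R) Pnear P0).
apply: filterS aN => b Nb /=.
have := NO b _ _ (@path_one _ _ _ _ a) (@path_one _ _ _ _ b) (Defs.constant x) Nb.
rewrite deviation_one => Hb.
(* [b] is recovered as [b / a] times [a]; the bridge is constant at [x], which is [a one] and so
   lies in [O]. *)
rewrite -[pi1_class b](divgK (pi1_class a)); apply: subgroup_mul => //.
by apply: Hb => _ [t _ <-]; move: Oa; rewrite path_one.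
Qed.

End fundamental_group_topology.

Theorem corollary3p3 (R : realType) (X : topologicalType) (x : X)
    (hX : locally_path_connected R X)
    (H : set (pi1 R x)) (hH : group_closed (mem H)) :
  open H <->
  exists V : path_from R x -> set X,
    path_open_cover V /\ path_spanier V `<=` H.
Proof.
split=> [|[V [cV VH]]]; first exact: open_path_spanier.
exact: (path_spanier_open hH hX cV VH).
Qed.
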